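(* Let $G$ be a topological group and let $f:G\to G$ be a homeomorphism. Then $f$ is topologically equivalent to a non-neutral shift in $G$ if and only if there exists a group operation $\oplus$ on the underlying space of $G$ such that $G'=\langle G,\oplus\rangle$ is topologically isomorphic to $G$ and $f$ is a non-neutral shift in $G'$.
   Context: For a topological group $G$ and another group operation $\oplus$ on its underlying set, $\langle G,\oplus\rangle$ denotes the underlying topological space of $G$ (with its topology unchanged) equipped with the operation $\oplus$. Two topological groups are topologically isomorphic if there is a group isomorphism between them that is also a homeomorphism. A shift in a group with operation $\oplus$ is a map of the form $x\mapsto x\oplus c$ for a fixed element $c$ of the group; it is non-neutral if $c$ is not the neutral element. Homeomorphisms $f$ and $h$ of a space $X$ are topologically equivalent (topologically conjugate) if there is a homeomorphism $t:X\to X$ with $tf=ht$. *)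

(* Defs.v *)
From HB Require Import structures.
From mathcomp Require Import all_boot.
From mathcomp Require Import all_classical topology.

Set Implicit Arguments.
Unset Strict Implicit.
Unset Printing Implicit Defensive.

Local Open Scope classical_set_scope.

(* A group together with a topology on its carrier, with no compatibility
   requirement yet. *)
#[short(type="topologizedGroupType")]
HB.structure Definition TopologizedGroup := {G of Group G & Topological G}.

(* No separation axiom is assumed. *)
Definition topological_group (G : topologizedGroupType) : Prop :=
  continuous (fun p : G * G => (p.1 * p.2)%g) /\
  continuous (fun x : G => (x^-1)%g).

Definition homeomorphism (X Y : topologicalType) (f : X -> Y) : Prop :=
  continuous f /\
  exists g : Y -> X, [/\ cancel f g, cancel g f & continuous g].

Definition topologically_equivalent (X : topologicalType) (f h : X -> X) : Prop :=
  exists t : X -> X, homeomorphism t /\ t \o f = h \o t.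

Definition topologically_isomorphic (G H : topologizedGroupType) : Prop :=
  exists t : G -> H, {morph t : x y / (x * y)%g} /\ homeomorphism t.

Definition nonneutral_shift (G : groupType) (f : G -> G) : Prop :=
  exists c : G, c <> 1%g /\ f = (fun x => (x * c)%g).

(* A group operation on the carrier of X, packed with its neutral element, its
   inverse map and the group axioms; the topology plays no part in it. *)
Definition group_operation (X : topologicalType) : Type := isGroup X.

(* <X, op>: the space X itself, with op as its group operation. Any group
   operation X may already have is not inherited, since X is only seen as a
   topologicalType. *)
Definition with_operation (X : topologicalType) (op : group_operation X) : Type := X.

HB.instance Definition _ (X : topologicalType) (op : group_operation X) :=
  Topological.on (with_operation op).
HB.instance Definition _ (X : topologicalType) (op : group_operation X) :=
  (op : isGroup (with_operation op)).

(* Main.v *)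
Require Import Defs.
From HB Require Import structures.
From mathcomp Require Import all_boot.
From mathcomp Require Import all_classical topology.

(** A conjugating homeomorphism and an isomorphism of topological groups are the
    same map. Let [t] be a homeomorphism with [t \o f = h \o t], where [h] is
    the shift by [c <> 1]. Pulling the operation of [G] back along [t], that is,
    putting [x (+) y := t^-1 (t x * t y)], makes [t] an isomorphism onto [G], and since
    [t] is a homeomorphism the new operations are continuous; moreover
    [f x = t^-1 (t x * c) = x (+) t^-1 c], so that [f] is the shift by [t^-1 c].
    Conversely, an isomorphism [t] from [<G, (+)>] to [G] satisfies
    [t (x (+) c) = t x * t c], hence it conjugates the shift by [c] to the shift
    by [t c]. As [t] is injective and matches the two neutral elements, neither
    step turns a non-neutral shift into a neutral one. *)

Section TransportedOperation.

Variables (X : topologicalType) (G : topologizedGroupType).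
Variables (t : X -> G) (u : G -> X).
Hypotheses (tK : cancel t u) (uK : cancel u t).

Let mul (x y : X) : X := u (t x * t y)%g.
Let inv (x : X) : X := u (t x)^-1%g.
Let one : X := u 1%g.

Let mulA : associative mul.
Proof. by move=> x y z; rewrite /mul !uK mulgA. Qed.

Let mul1 : left_id one mul.
Proof. by move=> x; rewrite /mul uK mul1g tK. Qed.

Let mulr1 : right_id one mul.
Proof. by move=> x; rewrite /mul uK mulg1 tK. Qed.

Let mulV : left_inverse one inv mul.
Proof. by move=> x; rewrite /mul uK mulVg. Qed.

Let mulrV : right_inverse one inv mul.
Proof. by move=> x; rewrite /mul uK mulgV. Qed.

Definition transported_operation : group_operation X :=
  isGroup.Build X mulA mul1 mulr1 mulV mulrV.

Lemma transported_operation_morph :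
  {morph (t : with_operation transported_operation -> G) : x y / (x * y)%g}.
Proof. by move=> x y; rewrite /= uK. Qed.

(** The transported product and inverse are composites of [t], the operations
    of [G] and [u]. The spaces are spelled out below because [with_operation]
    changes the group structure on [X] while keeping its topology. *)
Lemma transported_operation_topological :
  topological_group G -> continuous t -> continuous u ->
  topological_group (with_operation transported_operation).
Proof.
move=> [mul_cont inv_cont] t_cont u_cont; split.
- move=> [x y].
  apply: (@continuous_comp (X * X)%type G X
            (fun p => (t p.1 * t p.2)%g) u); last exact: u_cont.
  apply: (@continuous_comp (X * X)%type (G * G)%type G
            (fun p => (t p.1, t p.2)) (fun p => (p.1 * p.2)%g));
    last exact: mul_cont.
  apply: cvg_pair.
  + by apply: continuous_comp; [exact: cvg_fst | exact: t_cont].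
  + by apply: continuous_comp; [exact: cvg_snd | exact: t_cont].
- move=> x.
  apply: (@continuous_comp X G X (fun x => (t x)^-1%g) u); last exact: u_cont.
  by apply: continuous_comp; [exact: t_cont | exact: inv_cont].
Qed.

End TransportedOperation.

Theorem theorem2p8 (G : topologizedGroupType) (hG : topological_group G)
    (f : G -> G) (hf : homeomorphism f) :
  (exists h : G -> G, nonneutral_shift h /\ topologically_equivalent f h) <->
  (exists op : group_operation G,
     [/\ topological_group (with_operation op),
         topologically_isomorphic (with_operation op) G
       & nonneutral_shift (f : with_operation op -> with_operation op)]).
Proof.
split.
- move=> [_ [[c [c_neq1 ->]] [t [[t_cont [u [tK uK u_cont]]] tf]]]].
  exists (transported_operation G G t u tK uK); split.
  + exact: transported_operation_topological.
  + exists t; split; first exact: transported_operation_morph.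
    by split=> //; exists u.
  + exists (u c); split; first by move/(can_inj uK).
    apply/funext => x; rewrite -[LHS]tK.
    by rewrite [t (f x)](congr1 (@^~ x) tf) -[in LHS](uK c).
- move=> [op [_ [t [t_morph [t_cont [u [tK uK u_cont]]]]] [c [c_neq1 f_shift]]]].
  have t1 : t 1%g = 1%g by apply: (mulgI (t 1%g)); rewrite -t_morph !mulg1.
  exists (fun x => (x * t c)%g); split.
    by exists (t c); split=> // tc1; apply/c_neq1/(can_inj tK); rewrite tc1 t1.
  exists t; split; first by split=> //; exists u.
  by apply/funext => x; rewrite /= f_shift; exact: t_morph.
Qed.
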